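(* Assume that: (i) $W$ is closed and bounded, with $B_W=\sup_{w\in W}\|w\|>0$; (ii) there is $K\ge 0$ with $\|c(x)\|\le K$ for all $x\in\mathbb{R}^k$; (iii) $\hat c_0(x)=0$ for all $x$, and there is $B_\Phi\ge 0$ such that $\nabla_\theta\hat c_\theta(x)$ is piecewise continuous and bounded in norm by $B_\Phi$ for every $\theta\in\mathbb{R}^m$, $x\in\mathbb{R}^k$; (iv) $W$ is a polyhedron and there are $\alpha_0>0$, $\gamma\ge 0$ such that for every $\theta\in\mathbb{R}^m$ and every $t>0$, $\mathbb{P}(0<\Delta_\theta(x)\le\|\theta\|t)\le\left(\frac{\gamma t}{B_W}\right)^{\alpha_0}$; (v) for every $\theta\neq 0$, $\hat c_\theta(x)\neq 0$ almost surely, and for every $\theta$ with $\hat c_\theta(x)\ne 0$ almost surely, $\min_{w\in W}\hat c_\theta(x)^\top w$ has a unique solution almost surely. Then there exists $\alpha>0$ such that for every $u>0$ there is a constant $C\ge 0$ such that for all $\theta\in\mathbb{R}^m$ with $\|\theta\|\ge u$ and all $\beta\ge\beta^\star_{\mathcal H,P}$, $$\ell_P(\theta)\le\beta+C\,\ell_P^\beta(\theta)^{\,1-\frac{1}{1+\alpha}}.$$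
   Context: $P$ is a joint probability distribution of $(x,c)$ with $x\in\mathbb{R}^k$ (context) and $c\in\mathbb{R}^d$ (cost), and $c(x)=\mathbb{E}(c\mid x)$. $W\subset\mathbb{R}^d$ is a nonempty convex set of decisions. $\mathcal H=\{\hat c_\theta:\theta\in\mathbb{R}^m\}$ is a parametric family of measurable functions $\hat c_\theta:\mathbb{R}^k\to\mathbb{R}^d$; all expectations below are assumed finite. $\|\cdot\|$ is the Euclidean norm (operator norm for matrices). For $\tilde c\in\mathbb{R}^d$, $W^\star(\tilde c)=\arg\min_{w\in W}\tilde c^\top w$. $W^\angle$ is the set of extreme points of $W$, and $$\Delta_\theta(x)=\min_{w\in W^\angle\setminus W^\star(\hat c_\theta(x))}\hat c_\theta(x)^\top w-\min_{w\in W^\angle}\hat c_\theta(x)^\top w\ \text{ if } W^\star(\hat c_\theta(x))\neq W,\qquad \Delta_\theta(x)=0\ \text{ otherwise.}$$ The target loss is $\ell_P(\theta)=\mathbb{E}_{(x,c)\sim P}\big(\max_{w\in W^\star(\hat c_\theta(x))}c^\top w\big)$ and $\beta^\star_{\mathcal H,P}=\min_{\theta\in\mathbb{R}^m}\ell_P(\theta)$ (assumed attained). $W_P$ is the set of measurable mappings from contexts $x$ to $W$, $\overline W_P^\beta=\{w\in W_P:\ \mathbb{E}_{(x,c)\sim P}(c^\top w(x))\le\beta\}$, and $$\ell_P^\beta(\theta)=\min_{\overline w\in\overline W_P^\beta}\mathbb{E}_{(x,c)\sim P}\big(\hat c_\theta(x)^\top\overline w(x)\big)-\min_{w\in W_P}\mathbb{E}_{(x,c)\sim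 P}\big(\hat c_\theta(x)^\top w(x)\big).$$ *)

(* Defs.v *)
(* Vectors are row vectors over an arbitrary [R : realType].  The norm that
   MathComp-Analysis puts on matrices is the sup norm; it is used here only
   through its topology and its bounded sets, which are the Euclidean ones.
   Explicit norms are the Euclidean [enorm] and the induced [opnorm]. *)
From HB Require Import structures.
From mathcomp Require Import all_boot all_order all_algebra.
From mathcomp Require Import all_classical all_reals all_analysis.

Set Implicit Arguments.
Unset Strict Implicit.
Unset Printing Implicit Defensive.

Import Order.TTheory GRing.Theory Num.Theory.
Import numFieldNormedType.Exports.

Local Open Scope classical_set_scope.
Local Open Scope ring_scope.

(* Borel sigma-algebra, so that [probability ('rV[R]_k * 'rV[R]_d)%type R] is
   the type of Borel laws on R^k x R^d. *)
HB.instance Definition _ (R : realType) (m n : nat) :=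
  @isMeasurable.Build (sigma_display (@open 'M[R]_(m, n))) 'M[R]_(m, n)
    (<<s @open 'M[R]_(m, n) >>) (@sigma_algebra0 _ setT _)
    (@sigma_algebraC _ _) (@sigma_algebra_bigcup _ setT _).

Definition dotp (R : realType) (n : nat) (u v : 'rV[R]_n) : R :=
  \sum_(i < n) u 0 i * v 0 i.

Definition enorm (R : realType) (n : nat) (u : 'rV[R]_n) : R :=
  Num.sqrt (dotp u u).

(* Matrices act on row vectors from the right; transposing does not change the
   Euclidean operator norm. *)
Definition opnorm (R : realType) (m n : nat) (A : 'M[R]_(m, n)) : R :=
  sup [set enorm (v *m A) | v in [set v : 'rV[R]_m | enorm v <= 1]].

(* [g] is continuous, and its gradient is defined and continuous on the pieces
   of a locally finite family of disjoint open sets whose closures cover the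
   space, with a continuous extension to the closure of each piece.  The
   gradient may fail to exist on the boundaries between the pieces. *)
Definition piecewise_continuous_gradient (R : realType) (m d : nat)
    (g : 'rV[R]_m -> 'rV[R]_d) : Prop :=
  continuous g /\
  exists U : nat -> set 'rV[R]_m,
    [/\ forall i, open (U i),
        trivIset setT U,
        \bigcup_i closure (U i) = setT,
        forall p : 'rV[R]_m, exists2 V, nbhs p V &
          finite_set [set i | U i `&` V !=set0] &
        forall i, (forall p, U i p -> differentiable g p) /\
          exists2 G : 'rV[R]_m -> 'M[R]_(m, d),
            {within closure (U i), continuous G} &
            forall p, U i p -> 'J g p = G p].

Definition gradient_bounded_by (R : realType) (m d : nat)
    (g : 'rV[R]_m -> 'rV[R]_d) (B : R) : Prop :=
  forall p, differentiable g p -> opnorm ('J g p) <= B.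

Definition is_polyhedron (R : realType) (d : nat) (W : set 'rV[R]_d) : Prop :=
  exists (n : nat) (A : 'M[R]_(n, d)) (b : 'I_n -> R),
    W = [set w | forall i, dotp (row i A) w <= b i].

Definition norm_bound (R : realType) (d : nat) (W : set 'rV[R]_d) : R :=
  sup [set enorm w | w in W].

Definition extreme_points (R : realType) (d : nat) (W : set 'rV[R]_d) :
    set 'rV[R]_d :=
  [set w | W w /\
    forall (u v : 'rV[R]_d) (t : R), W u -> W v -> 0 < t < 1 ->
      w = t *: u + (1 - t) *: v -> u = w /\ v = w].

Definition argmin_set (R : realType) (d : nat) (W : set 'rV[R]_d)
    (ct : 'rV[R]_d) : set 'rV[R]_d :=
  [set w | W w /\ forall v, W v -> dotp ct w <= dotp ct v].

(* For a nonempty bounded polyhedron [W] there are finitely many extreme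
   points, so that the infima are minima. *)
Definition gap (R : realType) (d : nat) (W : set 'rV[R]_d)
    (ct : 'rV[R]_d) : R :=
  if `[< argmin_set W ct <> W >] then
    inf [set dotp ct w | w in extreme_points W `\` argmin_set W ct] -
    inf [set dotp ct w | w in extreme_points W]
  else 0.

(* For a nonempty compact [W] the supremum is a maximum. *)
Definition worst_cost (R : realType) (d : nat) (W : set 'rV[R]_d)
    (ct c : 'rV[R]_d) : R :=
  sup [set dotp c w | w in argmin_set W ct].

Section Losses.
Context (R : realType) (k d : nat).
Variable P : probability ('rV[R]_k * 'rV[R]_d)%type R.
Variable W : set 'rV[R]_d.

Local Open Scope ereal_scope.

(* [cbar] is a version of the conditional expectation of the cost given the
   context. *)
Definition is_cond_cost (cbar : 'rV[R]_k -> 'rV[R]_d) : Prop :=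
  measurable_fun setT cbar /\
  forall j : 'I_d,
    P.-integrable setT (fun z => (cbar z.1 ord0 j)%:E) /\
    forall A : set 'rV[R]_k, measurable A ->
      \int[P]_(z in fst @^-1` A) (z.2 ord0 j)%:E =
      \int[P]_(z in fst @^-1` A) (cbar z.1 ord0 j)%:E.

Definition policies : set ('rV[R]_k -> 'rV[R]_d) :=
  [set w | measurable_fun setT w /\ forall x, W (w x)].

Definition policies_le (beta : R) : set ('rV[R]_k -> 'rV[R]_d) :=
  [set w | policies w /\ 'E_P[fun z => dotp z.2 (w z.1)] <= beta%:E].

Definition target_loss (chat : 'rV[R]_k -> 'rV[R]_d) : \bar R :=
  'E_P[fun z => worst_cost W (chat z.1) z.2].

(* The infima are taken in the extended reals; they are equal to the minima
   whenever those are attained. *)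
Definition surrogate_loss (beta : R) (chat : 'rV[R]_k -> 'rV[R]_d) : \bar R :=
  ereal_inf [set 'E_P[fun z => dotp (chat z.1) (w z.1)]
            | w in policies_le beta] -
  ereal_inf [set 'E_P[fun z => dotp (chat z.1) (w z.1)] | w in policies].

Definition optimal_target_loss (m : nat)
    (chat : 'rV[R]_m -> 'rV[R]_k -> 'rV[R]_d) : \bar R :=
  ereal_inf [set target_loss (chat theta) | theta in setT].

Definition finite_expectations (m : nat)
    (chat : 'rV[R]_m -> 'rV[R]_k -> 'rV[R]_d) : Prop :=
  [/\ forall j : 'I_d, P.-integrable setT (fun z => (z.2 ord0 j)%:E),
      forall theta, P.-integrable setT
        (fun z => (worst_cost W (chat theta z.1) z.2)%:E),
      forall w, policies w ->
        P.-integrable setT (fun z => (dotp z.2 (w z.1))%:E) &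
      forall theta w, policies w ->
        P.-integrable setT (fun z => (dotp (chat theta z.1) (w z.1))%:E)].

End Losses.

(* Main.v *)
Require Import Defs.
From HB Require Import structures.
From mathcomp Require Import all_boot all_order all_algebra.
From mathcomp Require Import all_classical all_reals all_analysis.
From mathcomp Require Import measurable_realfun finmap ring lra.
Import Order.TTheory GRing.Theory Num.Theory.
Import numFieldNormedType.Exports.
Local Open Scope classical_set_scope.
Local Open Scope ring_scope.

Set Implicit Arguments.
Unset Strict Implicit.
Unset Printing Implicit Defensive.

(** Fix [theta] with [enorm theta >= u].  Almost surely the surrogate problem at
    [x] has a single solution [g x], which is a vertex of [W], so the target loss
    of [theta] is the expectation of [c . g x].  Let [w] be any policy whose
    expected cost is at most [beta].  Conditioning on the context,
      target loss - beta <= E (cbar x . (g x - w x)),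
    and the task is to compare this regret with the surrogate regret
      s w = E (chat theta x . (w x - g x)).

    The comparison is pointwise.  Unless the gap is positive and at most [a],
    every vertex other than [g x] has surrogate regret more than [a] (there may be
    no other vertex, and then the gap is 0), while by Cauchy-Schwarz no decision
    has regret more than [2 K B]; hence
      a (cbar . (g - w)) <= 2 K B (chat . (w - g))
    at every vertex [w].  Both sides are affine in [w], so this extends to all of
    [W], which is the convex hull of its vertices
    ([polyhedron_extreme_ind], [regret_le_surrogate_regret]).  Where the gap is
    positive and at most [a], only the bound [2 K B] is available, and the margin
    condition makes that event unlikely.  With [a = enorm theta * t] this gives
    ([excess_cost_le])
      target loss - beta
        <= 2 K B ((gamma t / B) ^ alpha0 + s w / (enorm theta * t)).
    For [delta > s w] the choice [t = delta ^ (1 / (1 + alpha0))] bounds both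
    terms by multiples of [delta ^ (alpha0 / (1 + alpha0))], with constants that
    depend on [theta] only through [u], so [alpha := alpha0] works;
    letting [delta] decrease to [s w] and minimizing over [w] replaces [delta] by
    the surrogate loss ([le_powR_right]).

    Two points need measure theory.  Replacing the cost by its conditional
    expectation against an arbitrary bounded measurable policy, when only the
    integrals over events of the context are known to agree, goes through simple
    functions ([integral_mul_comp_eq]).  The event of a small gap must be
    measurable for the margin condition to say anything about integrals; it is a
    finite Boolean combination of inequalities between vertex costs
    ([gap_vertexE]). *)

(** * Euclidean products and norms *)

Section DotProduct.
Context {R : realType} {n : nat}.
Implicit Types u v w : 'rV[R]_n.

Lemma dotpC u v : dotp u v = dotp v u.
Proof. by apply: eq_bigr => i _; rewrite mulrC. Qed.

Lemma dotpDr u v w : dotp u (v + w) = dotp u v + dotp u w.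
Proof. by rewrite -big_split; apply: eq_bigr => i _; rewrite mxE mulrDr. Qed.

Lemma dotpZr u a v : dotp u (a *: v) = a * dotp u v.
Proof. by rewrite mulr_sumr; apply: eq_bigr => i _; rewrite mxE mulrCA. Qed.

Lemma dotpBr u v w : dotp u (v - w) = dotp u v - dotp u w.
Proof. by rewrite dotpDr -scaleN1r dotpZr mulN1r. Qed.

Lemma dotp_ge0 u : 0 <= dotp u u.
Proof. by apply: sumr_ge0 => i _; rewrite -expr2 sqr_ge0. Qed.

Lemma enorm_ge0 u : 0 <= enorm u. Proof. exact: sqrtr_ge0. Qed.

Lemma sqr_enorm u : enorm u ^+ 2 = dotp u u.
Proof. by rewrite sqr_sqrtr // dotp_ge0. Qed.

Lemma dotp_eq0 u : dotp u u = 0 -> u = 0.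
Proof.
move=> /eqP; rewrite psumr_eq0; last by move=> i _; rewrite -expr2 sqr_ge0.
move=> /allP u0; apply/rowP => i; rewrite mxE.
by have /= := u0 i (mem_index_enum i); rewrite -expr2 sqrf_eq0 => /eqP.
Qed.

(** Cauchy-Schwarz, from [0 <= |dotp v v *: u - dotp u v *: v|^2]. *)
Lemma normr_dotp_le u v : `|dotp u v| <= enorm u * enorm v.
Proof.
rewrite -ler_sqr ?nnegrE ?normr_ge0 ?mulr_ge0 ?enorm_ge0 //.
rewrite exprMn !sqr_enorm real_normK ?num_real //.
have := dotp_ge0 v; rewrite le_eqVlt => /orP[/eqP v0|v_gt0].
  rewrite -v0 mulr0 (dotp_eq0 (esym v0)) -[0 : 'rV[R]_n](scale0r 0) dotpZr.
  by rewrite mul0r expr0n.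
rewrite -subr_ge0 -(pmulr_rge0 _ v_gt0).
have := dotp_ge0 (dotp v v *: u - dotp u v *: v).
rewrite !(dotpBr, dotpZr) ![dotp (_ - _) _]dotpC !(dotpBr, dotpZr).
rewrite [dotp v u]dotpC => /le_trans; apply.
by rewrite le_eqVlt; apply/orP; left; apply/eqP; ring.
Qed.

(** Boundedness is used only coordinatewise, which avoids relating the sup norm
    of the ambient space to the Euclidean norm. *)
Lemma bounded_set_coord (W : set 'rV[R]_n) : bounded_set W ->
  exists M, forall w, W w -> forall j, `|w 0 j| <= M.
Proof.
move=> [M [_ WM]]; exists (M + 1) => w Ww j.
apply: le_trans (WM (M + 1) _ w Ww); last by rewrite ltrDl.
by rewrite -[leRHS]/(mx_norm w) mx_normrE; apply: (le_bigmax _ _ (0, j)).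
Qed.

Lemma enorm_le_norm_bound (W : set 'rV[R]_n) w :
  bounded_set W -> W w -> enorm w <= norm_bound W.
Proof.
move=> /bounded_set_coord[M WM] Ww; apply: ub_le_sup; last by exists w.
exists (Num.sqrt (\sum_(i < n) M ^+ 2)) => _ [v Wv <-].
apply/ler_wsqrtr/ler_sum => i _; rewrite -expr2 -[leLHS]real_normK ?num_real //.
by rewrite ler_sqr ?nnegrE ?WM // (le_trans _ (WM v Wv i)).
Qed.

End DotProduct.

(** * Vertices of bounded polyhedra *)

Section Polyhedron.
Context {R : realType} {d n : nat} (A : 'M[R]_(n, d)) (b : 'I_n -> R).
Let W : set 'rV[R]_d := [set w | forall i, dotp (row i A) w <= b i].
Hypothesis W_bounded : bounded_set W.

Definition active (w : 'rV[R]_d) : {set 'I_n} :=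
  [set i | dotp (row i A) w == b i].

(** A ray from a point of [W] leaves [W] because [W] is bounded; the constraint
    that stops it is the one with the smallest exit time, and it is active at
    the exit point. *)
Lemma polyhedron_exit w (p : 'rV[R]_d) : W w -> p != 0 ->
  exists s i, [/\ 0 <= s, W (w + s *: p), 0 < dotp (row i A) p &
                  i \in active (w + s *: p)].
Proof.
move=> Ww p_neq0; have [[i0 pi0]|] := pselect (exists i, 0 < dotp (row i A) p).
  pose exit_time i := (b i - dotp (row i A) w) / dotp (row i A) p.
  case: (@arg_minP _ _ _ i0 (fun i => 0 < dotp (row i A) p) exit_time pi0).
  move=> i pi i_min; exists (exit_time i), i; split => //.
  - by rewrite divr_ge0 ?subr_ge0 ?Ww // ltW.
  - move=> j; rewrite dotpDr dotpZr -lerBrDl.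
    have [pj|pj] := ltP 0 (dotp (row j A) p).
      by rewrite -ler_pdivlMr // i_min.
    apply: (@le_trans _ _ 0); last by rewrite subr_ge0 Ww.
    by rewrite mulr_ge0_le0 // divr_ge0 ?subr_ge0 ?Ww // ltW.
  - by rewrite inE dotpDr dotpZr divfK ?(gt_eqF pi) // addrC subrK.
move=> no_exit; exfalso; have [M WM] := bounded_set_coord W_bounded.
have [j pj] : exists j, p 0 j != 0.
  apply/existsP; apply: contraNT p_neq0; rewrite negb_exists => /forallP p0.
  by apply/eqP/rowP => j; rewrite mxE; have := p0 j; rewrite negbK => /eqP.
(* Long enough for coordinate [j] of [w + s *: p] to exceed the bound [M]. *)
pose s := (M + `|w 0 j| + 1) / `|p 0 j|.
have M_ge0 : 0 <= M by apply: le_trans (WM w Ww j).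
have s_ge0 : 0 <= s by rewrite divr_ge0 // !addr_ge0.
have : W (w + s *: p).
  move=> i; rewrite dotpDr dotpZr -lerBrDl.
  apply: (@le_trans _ _ 0); last by rewrite subr_ge0 Ww.
  apply: mulr_ge0_le0 => //; rewrite leNgt.
  by apply/negP => pi; apply: no_exit; exists i.
move=> /WM /(_ j); rewrite !mxE; apply/negP; rewrite -ltNge.
have := ler_normB (w 0 j + s * p 0 j) (w 0 j).
rewrite addrAC subrr add0r normrM (ger0_norm s_ge0) divfK ?normr_eq0 //.
by move=> ?; lra.
Qed.

(** If [v] differed from the extreme point [w] and satisfied all its active
    constraints with equality, the ray from [v] through [w] would continue
    strictly beyond [w] inside [W], and [w] would be interior to a segment. *)
Lemma extreme_point_active w v : extreme_points W w -> W v ->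
  active w \subset active v -> v = w.
Proof.
move=> [Ww w_ext] Wv /fintype.subsetP wv; apply/eqP/negP => /negP v_neq_w.
have [|s [i [s_ge0 Wp pi ip]]] := @polyhedron_exit w (w - v) Ww.
  by rewrite subr_eq0 eq_sym.
have s_gt0 : 0 < s.
  rewrite lt_neqAle s_ge0 andbT; apply: contraTneq pi => s0.
  have iw : i \in active w by move: ip; rewrite -s0 scale0r addr0.
  have := wv i iw; move: iw; rewrite !inE dotpBr => /eqP-> /eqP->.
  by rewrite subrr ltxx.
have t01 : 0 < (1 + s)^-1 < 1.
  by rewrite invr_gt0 addr_gt0 //= invf_lt1 ?addr_gt0 // ltrDl.
have w_conv : w = (1 + s)^-1 *: (w + s *: (w - v)) + (1 - (1 + s)^-1) *: v.
  by apply/rowP => j; rewrite !mxE; field; rewrite gt_eqF // addr_gt0.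
by have [_ vw] := w_ext _ _ _ Wp Wv t01 w_conv; move: v_neq_w; rewrite vw eqxx.
Qed.

(** An extreme point is determined by its set of active constraints, and there
    are finitely many such sets. *)
Lemma finite_extreme_points : finite_set (extreme_points W).
Proof.
pose vertex J := xget 0 [set w | extreme_points W w /\ active w = J].
apply: (@sub_finite_set _ _ (vertex @` setT)); last exact: finite_image.
move=> w w_ext; exists (active w) => //=; rewrite /vertex.
case: xgetP => [v _ [[Wv _] vw]|/(_ w)]; last by case.
by apply: extreme_point_active => //; rewrite vw.
Qed.

(** Binary convex combinations suffice to express convexity, and avoid the
    interval-typed coefficients of [convex_set]. *)
Definition segment_closed (Q : set 'rV[R]_d) := forall u v t,
  0 < t < 1 -> Q u -> Q v -> Q (t *: u + (1 - t) *: v).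

(** The Minkowski theorem for polytopes, phrased as an induction principle.  A
    point that is not extreme lies inside a segment of [W]; pushing it both ways
    along this segment until it exits [W] keeps its active constraints and adds
    one, so the number of inactive constraints decreases. *)
Lemma polyhedron_extreme_ind (Q : set 'rV[R]_d) :
  segment_closed Q -> extreme_points W `<=` Q -> W `<=` Q.
Proof.
move=> Q_seg Q_ext w; have [k] := ubnP (n - #|active w|)%N.
elim: k w => // k IHk w wk Ww.
have [/Q_ext//|w_next] := pselect (extreme_points W w).
have [u [v [t [Wu Wv t01 w_conv uv]]]] : exists u v t,
    [/\ W u, W v, 0 < t < 1, w = t *: u + (1 - t) *: v & u != v].
  apply: contrapT => no_uv; apply: w_next; split=> // u v t Wu Wv t01 w_conv.
  have [uv|uv] := eqVneq u v; last by exfalso; apply: no_uv; exists u, v, t.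
  by rewrite w_conv -uv -scalerDl addrC subrK scale1r.
have dir0 i : i \in active w -> dotp (row i A) (u - v) = 0.
  rewrite inE w_conv dotpBr dotpDr !dotpZr => /eqP wi.
  have /andP[t0 t1] := t01; have := Wu i; have := Wv i; move: wi.
  move: (dotp _ u) (dotp _ v) => x y xy yb xb.
  have e : t * (b i - x) + (1 - t) * (b i - y) = 0 by move: xy; lra.
  have x_ge0 : 0 <= t * (b i - x) by rewrite mulr_ge0 ?subr_ge0 // ltW.
  have y_ge0 : 0 <= (1 - t) * (b i - y) by rewrite mulr_ge0 ?subr_ge0 // ltW.
  move: e => /eqP; rewrite paddr_eq0 // !mulf_eq0 !subr_eq0.
  by rewrite (gt_eqF t0) (gt_eqF t1) /= => /andP[/eqP<- /eqP<-]; rewrite subrr.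
have advance p : p != 0 -> (forall i, i \in active w -> dotp (row i A) p = 0) ->
    exists2 s, 0 < s & Q (w + s *: p).
  move=> p_neq0 p0; have [s [i [s_ge0 Wp pi ip]]] := polyhedron_exit Ww p_neq0.
  have iw : i \notin active w by apply: contraTN pi => /p0->; rewrite ltxx.
  have s_gt0 : 0 < s.
    rewrite lt_neqAle s_ge0 andbT; apply: contraNneq iw => s0.
    by move: ip; rewrite -s0 scale0r addr0.
  exists s => //; apply: IHk => //; rewrite -ltnS (leq_trans _ wk) // ltnS.
  apply: ltn_sub2l.
    rewrite -[n in (_ < n)%N]card_ord; apply/proper_card/properP.
    by split; [exact/fintype.subsetP|exists i].
  apply/proper_card/properP; split; last by exists i.
  apply/fintype.subsetP => j jw; move: (jw).
  by rewrite !inE dotpDr dotpZr p0 // mulr0 addr0.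
have uv0 : u - v != 0 by rewrite subr_eq0.
have [s s_gt0 Qs] := advance _ uv0 dir0.
have [|i iw|r r_gt0 Qr] := advance (v - u); first by rewrite subr_eq0 eq_sym.
  by rewrite -opprB -scaleN1r dotpZr dir0 // mulr0.
have sr : 0 < s + r by rewrite addr_gt0.
(* The weights are inversely proportional to the distances to the exit points. *)
have -> : w = (r / (s + r)) *: (w + s *: (u - v)) +
              (1 - r / (s + r)) *: (w + r *: (v - u)).
  by apply/rowP => j; rewrite !mxE; field; rewrite gt_eqF.
by apply: Q_seg => //; rewrite divr_gt0 //= ltr_pdivrMr // mul1r ltrDr.
Qed.

End Polyhedron.

(** The vertices come as a nonempty list [v0 :: V], the form that [best_vertex]
    takes; there is at least one, since otherwise [polyhedron_extreme_ind] with
    [Q := set0] would empty [W]. *)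
Lemma bounded_polyhedron_vertices (R : realType) (d : nat) (W : set 'rV[R]_d) :
  W !=set0 -> bounded_set W -> is_polyhedron W ->
  exists v0 V, extreme_points W = [set` v0 :: V] /\
    forall Q : set 'rV[R]_d,
      segment_closed Q -> extreme_points W `<=` Q -> W `<=` Q.
Proof.
move=> [w Ww] W_bounded [n [A [b WE]]]; rewrite WE in Ww W_bounded *.
have := finite_extreme_points W_bounded; move=> /finite_seqP[[|v0 V] VE].
  exfalso; have := polyhedron_extreme_ind W_bounded (Q := set0).
  by rewrite VE => /(_ _ _ w Ww); apply.
by exists v0, V; split=> // Q; exact: polyhedron_extreme_ind.
Qed.

(** * Linear optimization over the vertices *)

Section Vertices.
Context {R : realType} {d : nat}.
Implicit Types (ct w v : 'rV[R]_d) (V : seq 'rV[R]_d).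

(** A minimizer chosen by successive comparisons, so that it depends measurably
    on [ct]. *)
Fixpoint best_vertex v0 V ct : 'rV[R]_d :=
  if V is v :: V' then
    let best := best_vertex v0 V' ct in
    if dotp ct v <= dotp ct best then v else best
  else v0.

Lemma best_vertex_mem v0 V ct : best_vertex v0 V ct \in v0 :: V.
Proof.
elim: V => [|v V IH] /=; first by rewrite mem_seq1.
case: ifP => _; first by rewrite !inE eqxx orbT.
by move: IH; rewrite !inE => /orP[->|->]; rewrite ?orbT.
Qed.

Lemma best_vertex_le v0 V ct v :
  v \in v0 :: V -> dotp ct (best_vertex v0 V ct) <= dotp ct v.
Proof.
elim: V => [|u V IH] /=; first by rewrite mem_seq1 => /eqP->.
rewrite 2!inE orbCA => /orP[/eqP->|].
  by case: ifP => // /negbT; rewrite -ltNge => /ltW.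
by rewrite -in_cons => /IH; case: ifP => // /le_trans h /h.
Qed.

Lemma inf_dotp_seq v0 V ct :
  inf [set dotp ct w | w in [set` v0 :: V]] = dotp ct (best_vertex v0 V ct).
Proof.
apply/eqP; rewrite eq_le; apply/andP; split.
  apply: ge_inf; last first.
    by exists (best_vertex v0 V ct) => //; exact: best_vertex_mem.
  by exists (dotp ct (best_vertex v0 V ct)) => _ [w wV <-]; exact: best_vertex_le.
apply: lb_le_inf; first by exists (dotp ct v0), v0 => //=; rewrite mem_head.
by move=> _ [w wV <-]; exact: best_vertex_le.
Qed.

Context (W : set 'rV[R]_d) (v0 : 'rV[R]_d) (V : seq 'rV[R]_d).
Hypothesis vertices : extreme_points W = [set` v0 :: V].
Hypothesis vertex_ind : forall Q : set 'rV[R]_d,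
  segment_closed Q -> extreme_points W `<=` Q -> W `<=` Q.

Lemma vertexW v : v \in v0 :: V -> W v.
Proof. by move=> vV; have [] : extreme_points W v by rewrite vertices. Qed.

Lemma best_vertex_min ct w : W w -> dotp ct (best_vertex v0 V ct) <= dotp ct w.
Proof.
apply: (vertex_ind
  (Q := [set w | dotp ct (best_vertex v0 V ct) <= dotp ct w])).
  move=> u v t /andP[t0 t1] /= Qu Qv.
  have t1' : 0 <= 1 - t by rewrite subr_ge0 ltW.
  rewrite dotpDr !dotpZr.
  by have := lerD (ler_wpM2l (ltW t0) Qu) (ler_wpM2l t1' Qv); lra.
by move=> v; rewrite vertices; exact: best_vertex_le.
Qed.

Lemma best_vertex_argmin ct : argmin_set W ct (best_vertex v0 V ct).
Proof. by split; [exact/vertexW/best_vertex_mem|exact: best_vertex_min]. Qed.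

(** Membership of the gap in the interval from 0 (excluded) to [a] (included),
    without the infima: some vertex is suboptimal, but by at most [a].  The
    right-hand side is a finite test on [ct], hence measurable. *)
Lemma gap_vertexE ct (a : R) : (0 < gap W ct <= a) =
  has (fun v => has (fun v' => dotp ct v' < dotp ct v) (v0 :: V) &&
                all (fun v' => dotp ct v <= dotp ct v' + a) (v0 :: V))
      (v0 :: V).
Proof.
set m := dotp ct (best_vertex v0 V ct).
have argminE w : W w -> argmin_set W ct w <-> dotp ct w <= m.
  move=> Ww; split=> [[_]|wm]; first by apply; case: (best_vertex_argmin ct).
  by split=> // v Wv; apply: le_trans wm _; exact: best_vertex_min.
rewrite /gap; case: asboolP => [neqW|/contrapT eqW]; last first.
  rewrite ltxx andFb; apply/esym/negP => /hasP[v vV /andP[/hasP[v' v'V] + _]].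
  apply/negP; rewrite -leNgt; apply: le_trans (best_vertex_le ct v'V).
  by apply/argminE; [|rewrite eqW]; exact: vertexW.
(* The suboptimal vertices, kept abstract so that they can be split below. *)
have [F memF] : exists F : seq 'rV[R]_d,
    forall v, (v \in F) = (m < dotp ct v) && (v \in v0 :: V).
  by exists [seq v <- v0 :: V | m < dotp ct v] => v; exact: mem_filter.
have -> : extreme_points W `\` argmin_set W ct = [set` F].
  apply/seteqP; split=> v; rewrite vertices /= memF ltNge.
    move=> [vV nv]; rewrite vV andbT; apply/negP => vm.
    by apply: nv; apply/argminE => //; exact: vertexW.
  move=> /andP[/negP vm vV]; split=> //.
  by move=> /(argminE _ (vertexW vV)).
rewrite vertices inf_dotp_seq -/m; case: F memF => [|u0 U] memF.
  exfalso; apply: neqW; apply/seteqP; split=> [w []//|w Ww].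
  apply/argminE => //.
  apply: (vertex_ind (Q := [set w | dotp ct w <= m])) w Ww
    => [u v t /andP[t0 t1] /= Qu Qv|v].
    have t1' : 0 <= 1 - t by rewrite subr_ge0 ltW.
    rewrite dotpDr !dotpZr.
    by have := lerD (ler_wpM2l (ltW t0) Qu) (ler_wpM2l t1' Qv); lra.
  by rewrite vertices /= leNgt => vV; have := memF v; rewrite vV andbT => <-.
rewrite inf_dotp_seq; set u := best_vertex u0 U ct.
have := best_vertex_mem u0 U ct; rewrite memF => /andP[mu uV].
rewrite subr_gt0 mu andTb.
apply/idP/hasP => [ua|[v vV /andP[/hasP[v' v'V v'v] /allP va]]].
  exists u => //; apply/andP; split.
    by apply/hasP; exists (best_vertex v0 V ct) => //; exact: best_vertex_mem.
  apply/allP => v /(best_vertex_le ct) vm; rewrite -/m in vm; lra.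
have := va _ (best_vertex_mem v0 V ct); rewrite -/m => vm.
have : dotp ct u <= dotp ct v.
  apply: best_vertex_le; rewrite memF vV andbT.
  by apply: le_lt_trans v'v; exact: best_vertex_le.
by move=> ?; lra.
Qed.

(** The inequality is affine in [w], so only vertices matter.  At a vertex other
    than the minimizer the regret is at most [2 * K * B], and the surrogate regret
    exceeds [a], as a smaller one would put the gap between 0 and [a]. *)
Lemma regret_le_surrogate_regret (K B a : R) ct c :
  enorm c <= K -> (forall w, W w -> enorm w <= B) -> 0 < a ->
  argmin_set W ct = [set best_vertex v0 V ct] -> ~~ (0 < gap W ct <= a) ->
  forall w, W w ->
    a * (dotp c (best_vertex v0 V ct) - dotp c w) <=
    2 * K * B * (dotp ct w - dotp ct (best_vertex v0 V ct)).
Proof.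
set w0 := best_vertex v0 V ct => cK WB a_gt0 uniq_w0 ngap.
have w0V : w0 \in v0 :: V := best_vertex_mem v0 V ct.
have c_le w : W w -> `|dotp c w| <= K * B.
  move=> Ww; apply: le_trans (normr_dotp_le c w) _.
  by apply: ler_pM; rewrite ?enorm_ge0 ?WB.
apply: (vertex_ind (Q := [set w | a * (dotp c w0 - dotp c w) <=
    2 * K * B * (dotp ct w - dotp ct w0)])) => [u v t /andP[t0 t1] /= Qu Qv|v].
  rewrite !dotpDr !dotpZr.
  have t1' : 0 <= 1 - t by rewrite subr_ge0 ltW.
  by have := lerD (ler_wpM2l (ltW t0) Qu) (ler_wpM2l t1' Qv); lra.
rewrite vertices /= => vV; have [->|v_neq] := eqVneq v w0.
  by rewrite !subrr !mulr0.
have w0v : dotp ct w0 < dotp ct v.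
  rewrite ltNge; apply: contra_neqN v_neq => vw0.
  have : argmin_set W ct v.
    split=> [|w Ww]; first exact: vertexW.
    by apply: le_trans vw0 _; exact: best_vertex_min.
  by rewrite uniq_w0.
have a_lt : dotp ct w0 + a < dotp ct v.
  rewrite ltNge; apply: contraNN ngap => va; rewrite gap_vertexE; apply/hasP.
  exists v => //; apply/andP; split; first by apply/hasP; exists w0.
  apply/allP => v' v'V; apply: le_trans va _.
  by rewrite lerD2r; exact: best_vertex_le.
have := c_le _ (vertexW w0V); have := c_le _ (vertexW vV).
rewrite !ler_norml => /andP[vc _] /andP[_ w0c].
have KB_ge0 : 0 <= K * B by apply: le_trans (c_le _ (vertexW vV)).
apply: (@le_trans _ _ (a * (2 * K * B))).
  by rewrite ler_pM2l //; lra.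
by rewrite mulrC ler_wpM2l //; lra.
Qed.

End Vertices.

(** * Integrating against functions of the context *)

Import HBNNSimple.

Lemma bounded_of_le (R : realType) (S : Type) (D : set S) (f : S -> R) (M : R) :
  (forall x, D x -> `|f x| <= M) -> [bounded f x | x in D].
Proof.
move=> fM; exists M; split=> [|N MN x Dx]; first exact: num_real.
exact: le_trans (fM x Dx) (ltW MN).
Qed.

Section ConditionalExpectation.
Context {d1 d2 : measure_display}.
Context {T : measurableType d1} {U : measurableType d2}.
Context {R : realType} (mu : {measure set T -> \bar R}).
Local Open Scope ereal_scope.

Lemma integral_mul_nnsfun (f : T -> R) (g : T -> U) (s : {nnsfun U >-> R}) :
  measurable_fun setT g -> mu.-integrable setT (EFin \o f) ->
  \int[mu]_x (f x * s (g x))%:E =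
  \sum_(y <- fset_set (range s))
    y%:E * \int[mu]_(x in g @^-1` (s @^-1` [set y])) (f x)%:E.
Proof.
move=> mg intf.
pose B y := g @^-1` (s @^-1` [set y]).
have mB i : measurable (B i) by rewrite -[B i]setTI; exact: mg.
have intB i : mu.-integrable setT ((EFin \o f) \* (EFin \o \1_(B i))).
  apply: (@integrableMl _ _ _ _ _ measurableT (EFin \o f) (\1_(B i))) => //.
  apply: (bounded_of_le (M := 1)) => x _.
  by rewrite indicE; case: (_ \in _); rewrite ?normr1 ?normr0.
transitivity (\int[mu]_x (\sum_(y <- fset_set (range s))
    y%:E * ((EFin \o f) \* (EFin \o \1_(B y))) x)).
  apply: eq_integral => x _; rewrite fimfunE fsbig_finite //= mulr_sumr -sumEFin.
  by apply: eq_bigr => i _ /=; rewrite -!EFinM mulrCA !indicE.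
rewrite integral_sum //; last by move=> i; exact: integrableZl.
apply: eq_bigr => i _; rewrite integralZl //; congr (_ * _).
by rewrite [RHS]integral_mkcond; apply: eq_integral => x _; rewrite epatch_indic.
Qed.

(** Functions with the same integral on every event [g @^-1` A] are
    indistinguishable by bounded functions of [g].  Linearity gives this for
    simple [h], dominated convergence for [h >= 0], and a shift by [M] in
    general. *)
Lemma integral_mul_comp_eq (f1 f2 : T -> R) (g : T -> U) (h : U -> R) (M : R) :
  measurable_fun setT g -> measurable_fun setT h ->
  (forall y, (`|h y| <= M)%R) ->
  mu.-integrable setT (EFin \o f1) -> mu.-integrable setT (EFin \o f2) ->
  (forall A, measurable A ->
    \int[mu]_(x in g @^-1` A) (f1 x)%:E = \int[mu]_(x in g @^-1` A) (f2 x)%:E) ->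
  \int[mu]_x (f1 x * h (g x))%:E = \int[mu]_x (f2 x * h (g x))%:E.
Proof.
move=> mg mh hM int1 int2 f12.
pose h0 y := (h y + M)%R.
have h0_ge0 y : (0 <= h0 y)%R by have := hM y; rewrite ler_norml /h0; lra.
have h0_le y : (h0 y <= 2 * M)%R by have := hM y; rewrite ler_norml /h0; lra.
have mh0 : measurable_fun setT h0 by exact: measurable_funD.
have mEh0 : measurable_fun setT (EFin \o h0) by exact/measurable_EFinP.
pose s := nnsfun_approx measurableT mEh0.
have s_le n y : (s n y <= h0 y)%R.
  rewrite -lee_fin /s nnsfun_approxE; apply: le_approx => // z _.
  by rewrite /= lee_fin.
have lim f : mu.-integrable setT (EFin \o f) ->
    \int[mu]_x (f x * s n (g x))%:E @[n --> \oo] -->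
    \int[mu]_x (f x * h0 (g x))%:E.
  move=> intf; have mf : measurable_fun setT f.
    by apply/measurable_EFinP; exact: measurable_int intf.
  have [] // := @dominated_convergence _ _ _ mu setT measurableT
    (fun n x => (f x * s n (g x))%:E) (fun x => (f x * h0 (g x))%:E)
    (fun x => (2 * M)%:E * `|(EFin \o f) x|).
  - move=> n; apply/measurable_EFinP; apply: measurable_funM => //.
    exact: measurableT_comp.
  - apply/measurable_EFinP; apply: measurable_funM => //.
    exact: measurableT_comp.
  - apply: aeW => x _; apply: (@cvg_comp _ _ _ (fun n => f x * s n (g x))%R EFin
      _ (nbhs (f x * h0 (g x))%R)) => //.
    apply: cvgMr.
    have /fine_cvgP[_] : (s n (g x))%:E @[n --> \oo] --> (h0 (g x))%:E.
      by apply: cvg_nnsfun_approx => // y _; rewrite /= lee_fin.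
    exact.
  - by apply: integrableZl => //; exact: integrable_abse.
  - apply: aeW => x n _; rewrite /= lee_fin normrM mulrC ler_wpM2r //.
    by rewrite ger0_norm // (le_trans (s_le _ _)).
have h0_eq :
    \int[mu]_x (f1 x * h0 (g x))%:E = \int[mu]_x (f2 x * h0 (g x))%:E.
  rewrite -(cvg_lim (@ereal_hausdorff R) (lim _ int1)).
  rewrite -(cvg_lim (@ereal_hausdorff R) (lim _ int2)); congr (limn _).
  apply/funext => n; rewrite !integral_mul_nnsfun //.
  by apply: eq_bigr => i _; congr (_ * _); exact: f12.
have split_h f : mu.-integrable setT (EFin \o f) ->
    \int[mu]_x (f x * h (g x))%:E =
    \int[mu]_x (f x * h0 (g x))%:E - M%:E * \int[mu]_x (f x)%:E.
  move=> intf; have mf : measurable_fun setT f.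
    by apply/measurable_EFinP; exact: measurable_int intf.
  rewrite -integralZl // -integralB //.
  - apply: eq_integral => x _; rewrite /= -?EFinM -EFinB /h0.
    by congr EFin; ring.
  - apply: (@integrableMl _ _ _ _ _ measurableT (EFin \o f) (h0 \o g)) => //.
      exact: measurableT_comp.
    by apply: (bounded_of_le (M := 2 * M)) => x _; rewrite /= ger0_norm.
  - exact: integrableZl.
rewrite !split_h // h0_eq; congr (_ - _ * _).
by have := f12 setT measurableT; rewrite preimage_setT.
Qed.

End ConditionalExpectation.

(** * Measurability *)

Section Measurability.
Context {R : realType}.

Lemma measurable_coord (m n : nat) i j :
  measurable_fun setT (fun M : 'M[R]_(m, n) => M i j).
Proof.
apply: (measurability _ (RGenOpens.measurableE R)) => _ [_ [x [y ->]] <-].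
rewrite setTI; apply: sub_sigma_algebra.
move/continuousP: (@coord_continuous R m n i j); apply.
exact: interval_open.
Qed.

Context {d : measure_display} {T : measurableType d} {n : nat}.

Lemma measurable_dotp (f g : T -> 'rV[R]_n) :
  measurable_fun setT f -> measurable_fun setT g ->
  measurable_fun setT (fun x => dotp (f x) (g x)).
Proof.
move=> mf mg; apply: measurable_sum => i.
by apply: measurable_funM; apply: measurableT_comp (measurable_coord _ _) _.
Qed.

Lemma measurable_best_vertex v0 V (f : T -> 'rV[R]_n) :
  measurable_fun setT f ->
  measurable_fun setT (fun x => best_vertex v0 V (f x)).
Proof.
move=> mf; elim: V => [|v V IH] /=; first exact: measurable_cst.
apply: measurable_fun_ifT => //.
by apply: measurable_fun_ler; exact: measurable_dotp.
Qed.

Lemma measurable_has (I : Type) (s : seq I) (p : I -> T -> bool) :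
  (forall i, measurable_fun setT (p i)) ->
  measurable_fun setT (fun x => has (p^~ x) s).
Proof.
move=> mp; elim: s => [|i s IH] /=; last exact: measurable_or.
exact: measurable_cst.
Qed.

Lemma measurable_all (I : Type) (s : seq I) (p : I -> T -> bool) :
  (forall i, measurable_fun setT (p i)) ->
  measurable_fun setT (fun x => all (p^~ x) s).
Proof.
move=> mp; elim: s => [|i s IH] /=; last exact: measurable_and.
exact: measurable_cst.
Qed.

End Measurability.

(** * Real integrals and powers *)

Section IntegralFacts.
Context {d : measure_display} {T : measurableType d} {R : realType}.
Context (mu : {measure set T -> \bar R}).
Implicit Types f g : T -> R.

Lemma EFin_Rintegral f : mu.-integrable setT (EFin \o f) ->
  (\int[mu]_x f x)%R%:E = (\int[mu]_x (f x)%:E)%E.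
Proof. by move=> intf; rewrite fineK //; exact: integrable_fin_num. Qed.

(** The difference [g - f] agrees almost everywhere with its absolute value. *)
Lemma ae_le_Rintegral f g :
  mu.-integrable setT (EFin \o f) -> mu.-integrable setT (EFin \o g) ->
  {ae mu, forall x, f x <= g x} -> \int[mu]_x f x <= \int[mu]_x g x.
Proof.
move=> intf intg fg; rewrite -subr_ge0 -RintegralB //.
have int_gf : mu.-integrable setT (EFin \o (g \- f)).
  by rewrite (_ : _ \o _ = (EFin \o g) \- (EFin \o f))%E //; exact: integrableB.
have mgf := measurable_int _ int_gf.
rewrite /Rintegral fine_ge0 //.
rewrite (ae_eq_integral (fun x => `|(g x - f x)%:E|%E)) //.
- by apply: integral_ge0.
- exact: measurableT_comp.
by apply: filterS fg => x fgx _ /=; rewrite ger0_norm // subr_ge0.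
Qed.

End IntegralFacts.

(** Continuity of [z `^ p] from the right, in the form needed to pass to an
    infimum; it includes the boundary case [y = 0]. *)
Lemma le_powR_right (R : realType) (p C x y : R) :
  0 < p -> 0 < C -> 0 <= y ->
  (forall z, y < z -> x <= C * z `^ p) ->
  x <= C * y `^ p.
Proof.
move=> p_gt0 C_gt0 y_ge0 xz; have [x_le0|x_gt0] := leP x 0.
  by apply: le_trans x_le0 _; rewrite mulr_ge0 ?powR_ge0 // ltW.
rewrite -ler_pdivrMl // mulrC; have xC_gt0 : 0 < x / C by rewrite divr_gt0.
(* If [y] were below this root, the midpoint would violate the assumption. *)
pose root := (x / C) `^ p^-1.
have rootK : root `^ p = x / C by rewrite -powRrM mulVf ?gt_eqF // powRr1 // ltW.
have root_gt0 : 0 < root by rewrite powR_gt0.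
rewrite -rootK.
apply: ge0_ler_powR; rewrite ?nnegrE ?(ltW root_gt0) ?(ltW p_gt0) //.
rewrite leNgt; apply/negP => y_lt.
have /andP[mid_gt0 mid_lt] : 0 < (y + root) / 2 < root by lra.
have /xz : y < (y + root) / 2 by lra.
apply/negP; rewrite -ltNge.
rewrite mulrC -ltr_pdivlMr // -rootK.
by apply: gt0_ltr_powR; rewrite ?nnegrE // ltW.
Qed.

(** * Regret against surrogate regret *)

Section ExcessRisk.
Context {R : realType} {k d : nat}.
Context (P : probability ('rV[R]_k * 'rV[R]_d)%type R).
Context (cbar : 'rV[R]_k -> 'rV[R]_d).
Hypothesis cbar_cond : is_cond_cost P cbar.
Hypothesis cost_integrable : forall j : 'I_d,
  P.-integrable setT (fun z => (z.2 ord0 j)%:E).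

Lemma integrable_mul_coord (w : 'rV[R]_k -> 'rV[R]_d) (M : R)
    (f : 'rV[R]_k * 'rV[R]_d -> R) j :
  measurable_fun setT w -> (forall x j, `|w x 0 j| <= M) ->
  P.-integrable setT (EFin \o f) ->
  P.-integrable setT (fun z => (f z * w z.1 0 j)%:E).
Proof.
move=> mw wM intf; apply: (@integrableMl _ _ _ _ _ measurableT (EFin \o f)
  (fun z => w z.1 0 j)) => //.
  exact: measurableT_comp
    (measurableT_comp (measurable_coord _ _) mw) measurable_fst.
by apply: (bounded_of_le (M := M)) => z _.
Qed.

Lemma cond_cost_dotp (w : 'rV[R]_k -> 'rV[R]_d) (M : R) :
  measurable_fun setT w -> (forall x j, `|w x 0 j| <= M) ->
  (\int[P]_z (dotp z.2 (w z.1))%:E = \int[P]_z (dotp (cbar z.1) (w z.1))%:E)%E.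
Proof.
move=> mw wM; have [_ cbarE] := cbar_cond.
have mwj j : measurable_fun setT (fun x => w x 0 j).
  exact: measurableT_comp (measurable_coord _ _) mw.
under eq_integral do rewrite -sumEFin.
under [RHS]eq_integral do rewrite -sumEFin.
rewrite !integral_sum //; last first.
- by move=> j; exact: integrable_mul_coord j mw wM (cost_integrable j).
- move=> j; have [intj _] := cbarE j.
  exact: integrable_mul_coord j mw wM intj.
apply: eq_bigr => j _; have [intj eqj] := cbarE j.
apply: (@integral_mul_comp_eq _ _ _ _ _ P (fun z => z.2 0 j)
  (fun z => cbar z.1 0 j) fst (fun x => w x 0 j) M) => //.
exact: cost_integrable.
Qed.

Context (W : set 'rV[R]_d) (v0 : 'rV[R]_d) (V : seq 'rV[R]_d).
Hypothesis W_bounded : bounded_set W.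
Hypothesis vertices : extreme_points W = [set` v0 :: V].
Hypothesis vertex_ind : forall Q : set 'rV[R]_d,
  segment_closed Q -> extreme_points W `<=` Q -> W `<=` Q.

Lemma policy_expected_cost w : policies W w ->
  P.-integrable setT (fun z => (dotp (cbar z.1) (w z.1))%:E) /\
  \int[P]_z dotp z.2 (w z.1) = \int[P]_z dotp (cbar z.1) (w z.1).
Proof.
move=> [mw wW]; have [M WM] := bounded_set_coord W_bounded.
have cE := cond_cost_dotp mw (fun x => WM _ (wW x)).
split; last by rewrite /Rintegral cE.
have [_ cbarE] := cbar_cond.
rewrite (_ : (fun z => _) =
  (fun z => \sum_(j < d) (cbar z.1 0 j * w z.1 0 j)%:E)%E); last first.
  by apply/funext => z; rewrite sumEFin.
apply: integrable_sum => // j _; have [intj _] := cbarE j.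
exact: (integrable_mul_coord j mw (fun x => WM _ (wW x)) intj).
Qed.

Context (ct : 'rV[R]_k -> 'rV[R]_d) (K : R).
Hypothesis ct_meas : measurable_fun setT ct.
Hypothesis surrogate_integrable : forall w, policies W w ->
  P.-integrable setT (fun z => (dotp (ct z.1) (w z.1))%:E).
Hypothesis cbar_le : forall x, enorm (cbar x) <= K.
Hypothesis ct_uniq :
  {ae P, forall z, exists w, argmin_set W (ct z.1) = [set w]}.

Let greedy x := best_vertex v0 V (ct x).

Lemma greedy_policy : policies W greedy.
Proof.
split; first exact: measurable_best_vertex.
by move=> x; apply: (vertexW vertices); exact: best_vertex_mem.
Qed.

(** This makes the probability in the margin condition usable as the integral of
    an indicator. *)
Lemma measurable_gap_le (a : R) :
  measurable [set z : 'rV[R]_k * 'rV[R]_d | 0 < gap W (ct z.1) <= a].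
Proof.
pose test (z : 'rV[R]_k * 'rV[R]_d) := 0 < gap W (ct z.1) <= a.
suff mtest : measurable_fun setT test.
  by have := mtest measurableT [set true] I; rewrite setTI.
have mdot v :
    measurable_fun setT (fun z : 'rV[R]_k * 'rV[R]_d => dotp (ct z.1) v).
  apply: measurable_dotp; last exact: measurable_cst.
  exact: measurableT_comp ct_meas measurable_fst.
rewrite /test; under eq_fun do rewrite (gap_vertexE vertices vertex_ind).
apply: measurable_has => v; apply: measurable_and.
  by apply: measurable_has => v'; exact: measurable_fun_ltr.
apply: measurable_all => v'; apply: measurable_fun_ler => //.
exact: measurable_funD.
Qed.

(** Integration of the pointwise bound: the regret is at most [2 * K * B] on the
    event of a small gap, and at most [2 * K * B / a] times the surrogate regret
    elsewhere. *)
Lemma excess_cost_le (a p : R) (w : 'rV[R]_k -> 'rV[R]_d) :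
  0 < a -> policies W w ->
  (P [set z | (0 < gap W (ct z.1) <= a)%R] <= p%:E)%E ->
  \int[P]_z dotp z.2 (greedy z.1) <= \int[P]_z dotp z.2 (w z.1) +
    2 * K * norm_bound W * (p + a^-1 *
      (\int[P]_z dotp (ct z.1) (w z.1) -
       \int[P]_z dotp (ct z.1) (greedy z.1))).
Proof.
move=> a_gt0 w_pol Pgap; set G := [set z | _] in Pgap.
have mG : measurable G := measurable_gap_le a.
pose B := norm_bound W; rewrite -/B.
have WB u : W u -> enorm u <= B by exact: enorm_le_norm_bound.
have K_ge0 : 0 <= K by apply: le_trans (cbar_le 0); exact: enorm_ge0.
have B_ge0 : 0 <= B.
  by have [_ /(_ 0) /WB] := w_pol; apply: le_trans; exact: enorm_ge0.
have L_ge0 : 0 <= 2 * K * B by rewrite !mulr_ge0.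
have [int_cw ->] := policy_expected_cost w_pol.
have [int_cg ->] := policy_expected_cost greedy_policy.
have int_sw := surrogate_integrable w_pol.
have int_sg := surrogate_integrable greedy_policy.
have int_G : P.-integrable setT (fun z => (\1_G z)%:E).
  exact: integrable_indic.
pose regret (z : 'rV[R]_k * 'rV[R]_d) :=
  dotp (cbar z.1) (greedy z.1) - dotp (cbar z.1) (w z.1).
pose sregret (z : 'rV[R]_k * 'rV[R]_d) :=
  dotp (ct z.1) (w z.1) - dotp (ct z.1) (greedy z.1).
have int_s : P.-integrable setT (EFin \o sregret).
  rewrite (_ : _ \o _ = (fun z => (dotp (ct z.1) (w z.1))%:E) \-
    (fun z => (dotp (ct z.1) (greedy z.1))%:E))%E //.
  exact: integrableB.
have int_r : P.-integrable setT (EFin \o regret).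
  rewrite (_ : _ \o _ = (fun z => (dotp (cbar z.1) (greedy z.1))%:E) \-
    (fun z => (dotp (cbar z.1) (w z.1))%:E))%E //.
  exact: integrableB.
pose L := 2 * K * B.
have int_LG : P.-integrable setT (EFin \o (fun z => L * \1_G z)).
  rewrite (_ : _ \o _ = (fun z => L%:E * (\1_G z)%:E))%E //.
  exact: integrableZl.
have int_Ls : P.-integrable setT (EFin \o (fun z => L / a * sregret z)).
  rewrite (_ : _ \o _ = (fun z => (L / a)%:E * (EFin \o sregret) z))%E //.
  exact: integrableZl.
have int_bound : P.-integrable setT
    (EFin \o (fun z => L * \1_G z + L / a * sregret z)).
  rewrite (_ : _ \o _ = (EFin \o (fun z => L * \1_G z)%R) \+
    (EFin \o (fun z => L / a * sregret z)%R))%E //.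
  exact: integrableD.
have : \int[P]_z regret z <= \int[P]_z (L * \1_G z + L / a * sregret z).
  apply: ae_le_Rintegral => //; apply: filterS ct_uniq => z [w0 w0E].
  have greedyE : argmin_set W (ct z.1) = [set greedy z.1].
    have : argmin_set W (ct z.1) (greedy z.1) by exact: best_vertex_argmin.
    by rewrite w0E /= => <-.
  have [_ /(_ z.1) Ww] := w_pol; have [_ /(_ z.1) Wg] := greedy_policy.
  have s_ge0 : 0 <= sregret z.
    by rewrite subr_ge0; exact: (best_vertex_min vertices vertex_ind).
  rewrite indicE; have [zG|zG] := boolP (z \in G).
    have c_le u : W u -> `|dotp (cbar z.1) u| <= K * B.
      move=> Wu; apply: le_trans (normr_dotp_le _ u) _.
      by apply: ler_pM; rewrite ?enorm_ge0 ?WB.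
    have := c_le _ Wg; have := c_le _ Ww; rewrite !ler_norml /regret /L => ? ?.
    have : 0 <= 2 * K * B / a * sregret z.
      by rewrite mulr_ge0 // divr_ge0 // ltW.
    by rewrite mulr1; lra.
  have ngap : ~~ (0 < gap W (ct z.1) <= a).
    by apply: contraNN zG => ?; exact: mem_set.
  have := regret_le_surrogate_regret vertices vertex_ind (cbar_le z.1) WB a_gt0
    greedyE ngap Ww.
  by rewrite mulr0 add0r (mulrAC L) ler_pdivlMr // mulrC.
rewrite RintegralB // RintegralD // RintegralZl // RintegralZl // RintegralB //.
have : \int[P]_z \1_G z <= p.
  by rewrite -lee_fin EFin_Rintegral // integral_indic // setIT.
move=> /(ler_wpM2l L_ge0); rewrite /L -/B.
by move=> h1 h2; rewrite mulrDr mulrA; lra.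
Qed.

End ExcessRisk.

(** * The bound *)

Theorem theorem3 (R : realType) (k d m : nat)
  (P : probability ('rV[R]_k * 'rV[R]_d)%type R)
  (W : set 'rV[R]_d)
  (chat : 'rV[R]_m -> 'rV[R]_k -> 'rV[R]_d)
  (cbar : 'rV[R]_k -> 'rV[R]_d)
  (K BPhi alpha0 gamma : R)
  (W_nonempty : W !=set0)
  (W_convex : convex_set W)
  (chat_meas : forall theta, measurable_fun setT (chat theta))
  (cbar_cond : is_cond_cost P cbar)
  (finite_exp : finite_expectations P W chat)
  (min_attained : exists theta,
    target_loss P W (chat theta) = optimal_target_loss P W chat)
  (W_closed : closed W)
  (W_bounded : bounded_set W)
  (W_radius : 0 < norm_bound W)
  (K_ge0 : 0 <= K)
  (cbar_le : forall x, enorm (cbar x) <= K)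
  (chat0 : forall x, chat 0 x = 0)
  (BPhi_ge0 : 0 <= BPhi)
  (chat_grad : forall x,
    piecewise_continuous_gradient (fun theta => chat theta x) /\
    gradient_bounded_by (fun theta => chat theta x) BPhi)
  (W_polyhedron : is_polyhedron W)
  (alpha0_gt0 : 0 < alpha0)
  (gamma_ge0 : 0 <= gamma)
  (margin : forall theta (t : R), 0 < t ->
    (P [set z | (0 < gap W (chat theta z.1) <= enorm theta * t)%R]
     <= ((gamma * t / norm_bound W) `^ alpha0)%:E)%E)
  (chat_neq0 : forall theta, theta != 0 ->
    {ae P, forall z, chat theta z.1 != 0})
  (unique_sol : forall theta, {ae P, forall z, chat theta z.1 != 0} ->
    {ae P, forall z, exists w, argmin_set W (chat theta z.1) = [set w]}) :
  exists2 alpha : R, 0 < alpha &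
    forall u : R, 0 < u ->
      exists2 C : R, 0 <= C &
        forall (theta : 'rV[R]_m) (beta : R),
          u <= enorm theta ->
          (optimal_target_loss P W chat <= beta%:E)%E ->
          (target_loss P W (chat theta)
           <= beta%:E + C%:E *
              surrogate_loss P W beta (chat theta) `^ (1 - (1 + alpha)^-1))%E.
Proof.
have [v0 [V [vertices vertex_ind]]] :=
  bounded_polyhedron_vertices W_nonempty W_bounded W_polyhedron.
have [int_c int_worst int_cw int_sw] := finite_exp.
pose p := 1 - (1 + alpha0)^-1; pose B := norm_bound W.
have a1_gt0 : 0 < 1 + alpha0 by rewrite addr_gt0.
have pE : p = (1 + alpha0)^-1 * alpha0 by rewrite /p; field; rewrite gt_eqF.
have p_gt0 : 0 < p by rewrite pE mulr_gt0 // invr_gt0.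
exists alpha0 => // u u_gt0.
(* The summand 1 makes [C] positive, so that an infinite surrogate loss gives an
   infinite right-hand side. *)
pose C := 2 * K * B * ((gamma / B) `^ alpha0 + u^-1) + 1.
have L_ge0 : 0 <= 2 * K * B by rewrite !mulr_ge0 // ltW.
have C_gt0 : 0 < C.
  by rewrite ltr_pwDr // mulr_ge0 // addr_ge0 ?powR_ge0 // invr_ge0 ltW.
exists C => [|theta beta u_le _]; first exact: ltW.
rewrite -/p.
have theta_neq0 : theta != 0.
  apply: contraTneq u_le => ->; rewrite -ltNge.
  suff -> : enorm (0 : 'rV[R]_m) = 0 by [].
  by rewrite /enorm -[X in dotp _ X](scale0r (0 : 'rV[R]_m)) dotpZr mul0r sqrtr0.
have ct_uniq := unique_sol theta (chat_neq0 theta theta_neq0).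
pose ct := chat theta; pose greedy x := best_vertex v0 V (ct x).
have g_pol : policies W greedy := greedy_policy vertices (chat_meas theta).
pose T := \int[P]_z dotp z.2 (greedy z.1).
pose cost w := \int[P]_z dotp z.2 (w z.1).
pose scost w := \int[P]_z dotp (ct z.1) (w z.1).
have targetE : target_loss P W (chat theta) = T%:E.
  rewrite /target_loss unlock EFin_Rintegral; last exact: int_cw.
  apply: ae_eq_integral => //.
  - by have /measurable_int := int_worst theta.
  - by have /measurable_int := int_cw _ g_pol.
  apply: filterS ct_uniq => z [w0 w0E] _; congr EFin.
  have : argmin_set W (ct z.1) (greedy z.1) by exact: best_vertex_argmin.
  by rewrite /worst_cost w0E /= => ->; rewrite image_set1 sup1.
have scostE w : policies W w ->
    ('E_P[fun z => dotp (ct z.1) (w z.1)])%E = (scost w)%:E.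
  by move=> w_pol; rewrite unlock EFin_Rintegral //; exact: int_sw.
have scost_ge w : policies W w -> scost greedy <= scost w.
  move=> w_pol; apply: le_Rintegral => //; try exact: int_sw.
  by move=> z _; apply: (best_vertex_min vertices vertex_ind); case: w_pol.
have inf_policies : ereal_inf [set ('E_P[fun z => dotp (ct z.1) (w z.1)])%E
    | w in policies W] = (scost greedy)%:E.
  apply/eqP; rewrite eq_le; apply/andP; split.
    by apply: ereal_inf_lbound; exists greedy => //; exact: scostE.
  by apply/ereal_infP => _ [w w_pol <-]; rewrite scostE // lee_fin scost_ge.
have excess w : policies_le P W beta w ->
    T - beta <= C * (scost w - scost greedy) `^ p.
  move=> [w_pol]; rewrite unlock -EFin_Rintegral; last exact: int_cw.
  rewrite lee_fin => w_le.
  apply: le_powR_right => //; first by rewrite subr_ge0 scost_ge.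
  move=> delta delta_gt.
  have delta_gt0 : 0 < delta.
    by apply: le_lt_trans delta_gt; rewrite subr_ge0 scost_ge.
  (* This [t] balances [t ^ alpha0] against [delta / t]. *)
  pose t := delta `^ (1 + alpha0)^-1.
  have t_gt0 : 0 < t by rewrite powR_gt0.
  have theta_gt0 : 0 < enorm theta by exact: lt_le_trans u_le.
  have at_gt0 : 0 < enorm theta * t by rewrite mulr_gt0.
  have tp : t `^ alpha0 = delta `^ p by rewrite /t -powRrM pE.
  have tdelta : delta / t = delta `^ p.
    have pt : delta `^ p * t = delta.
      rewrite /t -powRD ?subrK ?powRr1 //; first exact: ltW.
      by rewrite (gt_eqF delta_gt0) implybT.
    by rewrite -{1}pt mulfK // gt_eqF.
  have := excess_cost_le cbar_cond int_c W_bounded vertices vertex_ind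
    (chat_meas theta) (int_sw theta) cbar_le ct_uniq at_gt0 w_pol
    (margin theta t t_gt0).
  rewrite -/ct -/greedy -/(cost w) -/(scost w) -/(scost greedy) -/T -/B => T_le.
  have probE : (gamma * t / B) `^ alpha0 = (gamma / B) `^ alpha0 * delta `^ p.
    rewrite mulrAC (powRM (x := gamma / B)) ?tp ?(ltW t_gt0) //.
    by rewrite divr_ge0 ?(ltW W_radius).
  have gain_le : (enorm theta * t)^-1 * (scost w - scost greedy) <=
      u^-1 * delta `^ p.
    rewrite -tdelta; apply: (@le_trans _ _ ((u * t)^-1 * delta)).
      apply: ler_pM; last exact: ltW.
      - by rewrite invr_ge0 ltW.
      - by rewrite subr_ge0 scost_ge.
      by rewrite lef_pV2 ?posrE ?mulr_gt0 // ler_pM2r.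
    by rewrite invfM -mulrA (mulrC t^-1).
  have delta_p : 0 <= delta `^ p by exact: powR_ge0.
  rewrite probE in T_le.
  have -> : C * delta `^ p =
      2 * K * B * ((gamma / B) `^ alpha0 * delta `^ p + u^-1 * delta `^ p) +
      delta `^ p.
    by rewrite /C; ring.
  rewrite lerBlDl addrA; apply: ler_wpDr => //; apply: le_trans T_le _.
  by apply: lerD => //; rewrite ler_wpM2l // lerD2l.
rewrite targetE /surrogate_loss inf_policies.
set I := ereal_inf _.
have I_ge : ((scost greedy)%:E <= I)%E.
  by apply/ereal_infP => _ [w [w_pol _] <-]; rewrite scostE // lee_fin scost_ge.
case IE : I I_ge => [r| |] //= I_ge; last first.
  by rewrite (gt_eqF p_gt0) gt0_muley ?lte_fin // addey // leey.
rewrite -EFinM -EFinD lee_fin -lerBlDl.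
apply: le_powR_right => //; first by rewrite subr_ge0 -lee_fin.
move=> delta delta_gt.
have : (I < (scost greedy + delta)%:E)%E by rewrite IE lte_fin; lra.
move=> /ereal_inf_lt[_ [w w_ok <-]].
have [w_pol _] := w_ok; rewrite scostE // lte_fin => w_lt.
apply: le_trans (excess w w_ok) _; rewrite ler_pM2l //.
have delta_ge0 : 0 <= delta.
  by apply: le_trans (ltW delta_gt); rewrite subr_ge0 -lee_fin.
apply: ge0_ler_powR; rewrite ?nnegrE ?(ltW p_gt0) ?subr_ge0 ?scost_ge //.
by rewrite lerBlDl ltW.
Qed.
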